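(* Let $p$ be a prime and $d,r\in\{0,1,\ldots,p-1\}$. For $i\in\{0,1,\ldots,r\}$ let $\varepsilon_i=\left(\frac{p-i-1}3\right)$ and $$f_i(\varepsilon_i)=\sum_{k=0}^{\lfloor (i+1-\varepsilon_i)/3\rfloor}(-1)^{k+\varepsilon_i}\binom{i+2}{3k+1+\varepsilon_i}\binom{k+(i-2+\varepsilon_i)/3}{i}+[\varepsilon_i=0\ \&\ 3\mid i+1]+[i=0]\left(3[\varepsilon_i=-1]-1\right).$$ Then $$(-1)^r\sum_{k=0}^{p-1}\binom{k+r}rC_{k+d}\equiv\sum_{0\le k<d}\binom{d-1-k}rC_k+\sum_{i=0}^{r}(-1)^{i}\binom d{r-i}f_i(\varepsilon_i)\pmod{p}.$$
   Context: $C_n=\frac1{n+1}\binom{2n}n$ is the $n$-th Catalan number. For any number $x$ and integer $k$: $\binom xk=\frac1{k!}\prod_{j=0}^{k-1}(x-j)$ if $k>0$, $\binom x0=1$, $\binom xk=0$ if $k<0$ (so the upper argument may be a rational number or negative). For an integer $a$, $\left(\frac a3\right)$ is the unique integer in $\{0,\pm1\}$ congruent to $a$ mod $3$. $[A]=1$ if assertion $A$ holds and $0$ otherwise. $\lfloor\cdot\rfloor$ is the floor function. For rationals $a,b$, $a\equiv b\pmod p$ means $a-b=u/v$ with integers $u,v$, $p\nmid v$, $p\mid u$. *)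

(* Defs.v *)
From mathcomp Require Export all_boot all_order all_algebra.
Export Order.TTheory GRing.Theory Num.Theory.

Set Implicit Arguments.
Unset Strict Implicit.
Unset Printing Implicit Defensive.

Local Open Scope ring_scope.

Definition binomq (x : rat) (k : int) : rat :=
  match k with
  | Posz n => (n`!%:R)^-1 * \prod_(0 <= j < n) (x - j%:R)
  | Negz _ => 0
  end.

Definition catalan (n : nat) : rat := (n.+1%:R)^-1 * binomq (2 * n)%:R n.

(* The symbol (a / 3). *)
Definition leg3 (a : int) : int :=
  if (a %% 3)%Z == 1 then 1 else if (a %% 3)%Z == 2 then -1 else 0.

Lemma leg3P (a e : int) :
  e \in [:: 0; 1; -1] -> (e == a %[mod 3])%Z = (e == leg3 a).
Proof.
have a3 : [|| (a %% 3)%Z == 0, (a %% 3)%Z == 1 | (a %% 3)%Z == 2].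
  have := modz_ge0 a (isT : 3 != 0 :> int).
  have := ltz_mod a (isT : 3 != 0 :> int).
  by case: (a %% 3)%Z => [[|[|[|n]]]|n].
rewrite !inE /leg3.
by case/or3P: a3 => /eqP -> /or3P[] /eqP ->.
Qed.

Definition qcong (p : nat) (a b : rat) : Prop :=
  exists u v : int,
    [/\ a - b = u%:Q / v%:Q, ~~ (p%:Z %| v)%Z & (p%:Z %| u)%Z].

Definition eps (p i : nat) : int := leg3 (p%:Z - i%:Z - 1).

(* Meant for e in {0, 1, -1}: then i + 1 - e >= 0, so the floor is nonnegative
   and `|_|%N is just its value as a natural number. *)
Definition f_ (i : nat) (e : int) : rat :=
  \sum_(0 <= k < `|Num.floor ((i%:Z + 1 - e)%:Q / 3)|%N.+1)
     (-1) ^ (k%:Z + e) * binomq (i + 2)%:R (3 * k%:Z + 1 + e)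
       * binomq (k%:R + (i%:Z - 2 + e)%:Q / 3) i
  + ((e == 0) && (3 %| i.+1)%N)%:R
  + (i == 0%N)%:R * (3 * (e == -1)%:R - 1).

(* Main.v *)
(** In characteristic p one has [(-1)^r C(k+r,r) = C(p-1-k,r)] and, writing the Catalan
    number [C_n] as the coefficient of [X^(n+1)] in [(X-1)(1+X)^(2n)], also
    [C_(n+p) = 2 C_n] for [n <= p-2].  Shifting the summation index by [d] therefore
    produces the sum over [k < d] plus [sum_(m<p) C(d+p-1-m,r) C_m], which Vandermonde's
    identity reduces to the sums [B_i = sum_(m<p) C(m+i,i) C_m].

    With [N = p-1-i], the binomial theorem makes [B_i] the coefficient of [X^(N+1)] in
    [(X-1)(-(1+X+X^2))^N].  Since [(1-X)^p = 1-X^p], up to sign this is that of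
    [(1-X^3)^N (1-X)^(i+2) / (1-X^p)]; expanding both powers gives [f_i], the
    denominator contributing only when [i = 0]. *)

Require Import Defs.
From mathcomp Require Import ring zify.

Set Implicit Arguments.
Unset Strict Implicit.
Unset Printing Implicit Defensive.

Local Open Scope ring_scope.

(** * Binomial coefficients in characteristic [p] *)

Lemma coef_exp1ZX (R : comNzRingType) (a : R) (n k : nat) :
  ((1 + a *: 'X) ^+ n)`_k = a ^+ k *+ 'C(n, k).
Proof.
elim: n k => [|n IHn] [|k]; rewrite ?expr0 ?coef1 //.
- by rewrite exprS mulrDl mul1r coefD IHn -scalerAl coefZ coefXM /= mulr0 addr0 !bin0.
- rewrite exprS mulrDl mul1r coefD !IHn -scalerAl coefZ coefXM /= IHn binS.
  by rewrite mulrnDr mulrnAr -exprS.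
Qed.

Lemma natr_ffact (R : comNzRingType) (n m : nat) :
  (n ^_ m)%:R = \prod_(0 <= j < m) (n%:R - j%:R) :> R.
Proof.
elim: m => [|m IHm]; first by rewrite big_geq.
rewrite ffactnSr natrM IHm big_nat_recr //=.
have [le_mn|lt_nm] := leqP m n; first by rewrite natrB.
(* Here [n - m] is truncated to 0, and on the right the factor [j = n] vanishes, so both sides are
   0. *)
rewrite (bigD1_seq n) ?mem_index_iota ?iota_uniq //= subrr.
by rewrite !mul0r.
Qed.

Lemma pchar_fact_neq0 (F : fieldType) (p n : nat) :
  p \in [pchar F] -> (n < p)%N -> n`!%:R != 0 :> F.
Proof.
move=> charFp lt_np; rewrite -(dvdn_pcharf charFp) fact_prod.
have p_pr := pcharf_prime charFp.
apply/negP; rewrite big_seq; apply: (big_ind (fun m => ~ (p %| m)%N)).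
- by rewrite dvdn1 => /eqP p1; rewrite p1 in p_pr.
- by move=> x y hx hy; rewrite Euclid_dvdM // => /orP[].
- move=> m; rewrite mem_index_iota => /andP[m_gt0 lt_mn] /dvdn_leq; lia.
Qed.

(** For [m < p] the factorial of [m] is invertible, so the binomial is a polynomial in the residue
    of [n]. This is what allows shifting [n] by [p] and negating it. *)
Lemma natr_bin (F : fieldType) (p n m : nat) :
  p \in [pchar F] -> (m < p)%N ->
  'C(n, m)%:R = m`!%:R^-1 * \prod_(0 <= j < m) (n%:R - j%:R) :> F.
Proof.
move=> charFp lt_mp; have fm0 := pchar_fact_neq0 charFp lt_mp.
apply: (mulIf fm0).
by rewrite -natrM bin_ffact natr_ffact mulrAC mulVf ?mul1r.
Qed.

Lemma bin_addp_pchar (F : fieldType) (p n m : nat) :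
  p \in [pchar F] -> (m < p)%N -> 'C(n + p, m)%:R = 'C(n, m)%:R :> F.
Proof.
move=> charFp lt_mp.
by rewrite !(natr_bin _ charFp) // natrD (pcharf0 charFp) addr0.
Qed.

(** Upper negation: the right side is the polynomial binomial of [-k-1] over [r]. *)
Lemma sign_bin_add (F : fieldType) (p k r : nat) :
  p \in [pchar F] -> (r < p)%N ->
  (-1) ^+ r * 'C(k + r, r)%:R
    = r`!%:R^-1 * \prod_(0 <= j < r) (- k%:R - 1 - j%:R) :> F.
Proof.
move=> charFp lt_rp; rewrite (natr_bin _ charFp) // mulrCA; congr (_ * _).
rewrite -[X in (-1) ^+ X]subn0 -prodr_const_nat -big_split /= big_nat_rev /=.
apply: eq_big_nat => j /andP[_ lt_jr].
by rewrite add0n natrB // natrD -(natr1 j); ring.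
Qed.

Lemma bin_neg_pchar (F : fieldType) (p k r : nat) :
  p \in [pchar F] -> (k < p)%N -> (r < p)%N ->
  (-1) ^+ r * 'C(k + r, r)%:R = 'C(p.-1 - k, r)%:R :> F.
Proof.
move=> charFp lt_kp lt_rp; rewrite (sign_bin_add _ charFp) // (natr_bin _ charFp) //.
congr (_ * _); apply: eq_bigr => j _; congr (_ - _).
have -> : (p.-1 - k = p - k.+1)%N by lia.
by rewrite natrB // (pcharf0 charFp) -natr1; ring.
Qed.

(** * Catalan numbers in characteristic [p] *)

(* Unlike the quotient by [n.+1], the difference of binomials makes sense in every
   characteristic *)
Definition catr (R : pzRingType) (n : nat) : R :=
  'C(2 * n, n)%:R - 'C(2 * n, n.+1)%:R.

Lemma catr_coef (R : comNzRingType) (n : nat) :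
  catr R n = (('X - 1) * (1 + 'X) ^+ (2 * n))`_n.+1.
Proof.
have cf k : ((1 + 'X) ^+ (2 * n))`_k = 'C(2 * n, k)%:R :> R.
  by rewrite -['X]scale1r coef_exp1ZX expr1n.
by rewrite mulrBl mul1r coefB coefXM /= !cf.
Qed.

Lemma poly_exp1D_pchar (F : fieldType) (p : nat) (q : {poly F}) :
  p \in [pchar F] -> (1 + q) ^+ p = 1 + q ^+ p.
Proof.
move=> charFp; have charPp : p \in [pchar {poly F}] by rewrite pchar_poly.
by rewrite -!(pFrobenius_autE charPp) rmorphD rmorph1.
Qed.

(** Adding [p] to [l] multiplies [Q] by [(1+X)^(2p) = 1 + 2X^p + X^(2p)]. In degree [l+p+1] the
    first term gives nothing since [Q] has degree at most [2l+1], and the last starts only at degree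
    [2p]; the middle one gives [2 Q_(l+1)]. *)
Lemma catrDp (F : fieldType) (p l : nat) :
  p \in [pchar F] -> (l.+1 < p)%N -> catr F (l + p) = 2 * catr F l.
Proof.
move=> charFp lt_lp; rewrite !catr_coef.
set Q := ('X - 1) * (1 + 'X) ^+ (2 * l).
have szQ k : (2 * l + 2 <= k)%N -> Q`_k = 0.
  have sz1 : (size ((1 + 'X) ^+ (2 * l) : {poly F}) <= (2 * l).+1)%N.
    by rewrite (leq_trans (size_poly_exp_leq _ _)) // addrC -polyC1 size_XaddC mul1n.
  move=> le_k; apply: nth_default; apply: leq_trans le_k.
  have szX : size ('X - 1 : {poly F}) = 2%N by rewrite -polyC1 size_XsubC.
  rewrite (leq_trans (size_polyMleq _ _)) // szX.
  by move: sz1; set s := size _ => sz1; lia.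
have -> : ('X - 1) * (1 + 'X) ^+ (2 * (l + p)) = Q + 2%:R *: (Q * 'X^p) + Q * 'X^(2 * p).
  have -> : 'X^(2 * p) = 'X^p * 'X^p :> {poly F} by rewrite mul2n -addnn exprD.
  rewrite mulnDr exprD [(2 * p)%N]mulnC (exprM _ p) mulrA -/Q (poly_exp1D_pchar _ charFp).
  by rewrite scaler_nat; ring.
rewrite !coefD coefZ !coefMXn szQ; last by lia.
have -> : ((l + p).+1 < p)%N = false by lia.
have -> : ((l + p).+1 < 2 * p)%N by lia.
by rewrite -addSn addnK add0r addr0.
Qed.

(** * The sums [B_i] of [C(m+i,i) C_m] over [m < p] *)

Lemma signr_eq_odd (R : pzRingType) (m n : nat) :
  odd m = odd n -> (-1) ^+ m = (-1) ^+ n :> R.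
Proof. by rewrite -signr_odd => ->; rewrite signr_odd. Qed.

(** Frobenius treats all primes alike, including [p = 2], where [-1 = 1]. *)
Lemma signr_pchar (F : fieldType) (p : nat) :
  p \in [pchar F] -> (-1) ^+ p = -1 :> F.
Proof. by move=> charFp; rewrite -(pFrobenius_autE charFp) rmorphN1. Qed.

Lemma bin_addr_pchar (F : fieldType) (p m i : nat) :
  p \in [pchar F] -> (m < p)%N -> (i < p)%N ->
  'C(m + i, i)%:R = (-1) ^+ m * 'C(p.-1 - i, m)%:R :> F.
Proof.
move=> charFp lt_mp lt_ip; rewrite -(bin_neg_pchar charFp) //.
rewrite mulrA -exprMn mulrNN mulr1 expr1n mul1r.
by rewrite -[in RHS]bin_sub ?leq_addl // addnK addnC.
Qed.

(** The weight [C(m+i,i)] is [(-1)^m C(N,m)], which vanishes for [m > N]. Multiplying by [X^(N-m)]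
    moves every Catalan coefficient to the common degree [N+1], and the binomial theorem sums the
    polynomials. *)
Lemma sum_catr_coef (F : fieldType) (p i : nat) :
  p \in [pchar F] -> (i < p)%N ->
  \sum_(0 <= m < p) 'C(m + i, i)%:R * catr F m
    = (('X - 1) * ('X - (1 + 'X) ^+ 2) ^+ (p.-1 - i))`_(p.-1 - i).+1.
Proof.
move=> charFp lt_ip; set N := (p.-1 - i)%N.
have lt_Np : (N < p)%N by rewrite /N; lia.
rewrite (big_cat_nat_idem _ (n := N.+1)) //=; last exact: addr0.
rewrite [X in _ + X]big1_seq ?addr0; last first.
  move=> m /andP[_]; rewrite mem_index_iota => /andP[lt_Nm lt_mp].
  by rewrite (bin_addr_pchar charFp) // bin_small // mulr0 mul0r.
rewrite exprDn mulr_sumr coef_sum big_mkord; apply: eq_bigr => -[m /= lt_mN] _.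
rewrite (bin_addr_pchar charFp) -/N //; last by lia.
have -> : ('X - 1) * ('X^(N - m) * (- (1 + 'X) ^+ 2) ^+ m *+ 'C(N, m))
   = ((-1) ^+ m * 'C(N, m)%:R) *: (('X - 1) * (1 + 'X) ^+ (2 * m) * 'X^(N - m)) :> {poly F}.
  rewrite -mul_polyC polyCM rmorphXn /= polyCN polyC1 polyC_natr exprNn -exprM.
  by ring.
rewrite coefZ coefMXn ltnNge (leq_trans (leq_subr _ _)) //=.
by rewrite catr_coef; congr (_ * _`__); lia.
Qed.

Lemma sum_catr_bin (F : fieldType) (p i : nat) (N := (p.-1 - i)%N) :
  p \in [pchar F] -> (i < p)%N ->
  \sum_(0 <= m < p) 'C(m + i, i)%:R * catr F m
    = \sum_(0 <= k < N.+1)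
        (if (N.+1 < 3 * k)%N then 0
         else (-1) ^+ k * 'C(k + i, i)%:R * 'C(i + 2, N.+1 - 3 * k)%:R)
      - (i == 0%N)%:R.
Proof.
move=> charFp lt_ip; rewrite sum_catr_coef // -/N.
set P : {poly F} := (1 - 'X) * (1 + 'X + 'X ^+ 2) ^+ N.
have -> : ('X - 1) * ('X - (1 + 'X) ^+ 2) ^+ N = (-1) ^+ N.+1 *: P.
  have -> : 'X - (1 + 'X) ^+ 2 = - (1 + 'X + 'X ^+ 2) :> {poly F} by ring.
  rewrite -mul_polyC polyC_exp polyCN polyC1 [in LHS]exprNn (exprS _ N) /P.
  set A := (_ + _) ^+ N; set B := (-1) ^+ N.
  by ring.
(* [(1 - X)^(N + i + 1) = 1 - X^p], so [1 - X^p] turns the trinomial into [1 - X^3] *)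
have PXp : P * (1 - 'X^p) = (1 - 'X^3) ^+ N * (1 - 'X) ^+ (i + 2).
  have charPp : p \in [pchar {poly F}] by rewrite pchar_poly.
  have -> : 1 - 'X^p = (1 - 'X) ^+ p :> {poly F}.
    by rewrite -!(pFrobenius_autE charPp) rmorphB rmorph1.
  have -> : 1 - 'X^3 = (1 - 'X) * (1 + 'X + 'X ^+ 2) :> {poly F} by ring.
  have -> : p = (N + i.+1)%N by rewrite /N; lia.
  rewrite /P exprMn !exprD (exprS _ i).
  by set A := (1 + _ + _) ^+ N; set B := (1 - _) ^+ N; set C := (1 - _) ^+ i; ring.
(* The factor [X^p] reaches degree [N+1 = p-i] only for [i = 0], where it removes the constant term
   1 of [P]. *)
have coefP : P`_N.+1 = (P * (1 - 'X^p))`_N.+1 + (i == 0%N)%:R.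
  rewrite mulrBr mulr1 coefB coefMXn.
  have [i0|i_neq0] := eqVneq i 0%N.
    have -> : N.+1 = p by rewrite /N; lia.
    rewrite ltnn subnn -[P`_0]horner_coef0 /P !hornerE expr0n /= !addr0 subr0.
    by rewrite expr1n mul1r subrK.
  by rewrite ifT ?subr0 ?addr0 // /N; lia.
rewrite coefZ coefP mulrDr; congr (_ + _); last first.
  case: eqVneq => [i0|_]; last by rewrite mulr0 oppr0.
  have -> : N.+1 = p by rewrite /N; lia.
  by rewrite signr_pchar ?mulr1.
rewrite PXp exprDn mulr_suml coef_sum mulr_sumr big_mkord.
apply: eq_bigr => -[k /= lt_kN] _.
rewrite expr1n mul1r.
have -> : (- 'X^3) ^+ k *+ 'C(N, k) * (1 - 'X) ^+ (i + 2)
  = ((-1) ^+ k * 'C(N, k)%:R) *: ((1 + (-1) *: 'X) ^+ (i + 2) * 'X^(3 * k)) :> {poly F}.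
  rewrite -mul_polyC polyCM rmorphXn /= polyCN polyC1 polyC_natr exprNn -exprM.
  by rewrite scaleN1r; ring.
rewrite coefZ coefMXn; case: ltnP => [_|le_k]; first by rewrite !mulr0.
rewrite coef_exp1ZX (bin_addr_pchar charFp) -/N //; last by rewrite /N in lt_kN; lia.
rewrite -mulr_natr [in RHS]mulrA -exprD.
have -> : (-1) ^+ (k + k) = (-1) ^+ N.+1 * (-1) ^+ k * (-1) ^+ (N.+1 - 3 * k) :> F.
  by rewrite -!exprD; apply: signr_eq_odd; lia.
by ring.
Qed.

(** Since [N+1 = 3q+s], the substitution [k = q-j] turns the lower index [N+1-3k] into [3j+s], the
    shape found in [f_]. *)
Lemma sum_catr_rev (F : fieldType) (p i q s : nat) :
  p \in [pchar F] -> (i < p)%N -> (s < 3)%N -> (p - i = 3 * q + s)%N ->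
  \sum_(0 <= m < p) 'C(m + i, i)%:R * catr F m
    = \sum_(0 <= j < q.+1)
        (-1) ^+ (q - j) * 'C(q - j + i, i)%:R * 'C(i + 2, 3 * j + s)%:R
      - (i == 0%N)%:R :> F.
Proof.
move=> charFp lt_ip lt_s3 pi_qs; rewrite sum_catr_bin //; congr (_ - _).
have -> : (p.-1 - i).+1 = (p - i)%N by lia.
rewrite (big_cat_nat_idem _ (n := q.+1)) //=; [|exact: addr0|lia].
rewrite [X in _ + X]big1_seq ?addr0; last first.
  move=> m /andP[_]; rewrite mem_index_iota => lt_qm.
  by rewrite ifT //; lia.
rewrite big_nat_rev /=; apply: eq_big_nat => j lt_j.
rewrite add0n subSS ifF; last by lia.
by congr (_ * 'C(_, _)%:R); lia.
Qed.

(** Upper negation turns [(-1)^i C(q-j+i,i)] into the polynomial binomial of [j-q-1] over [i]. The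
    upper limit may then change from [q] to [J]: past [J] the coefficient [C(i+2,3j+s)] is 0, and
    for [q < j <= J] the product has the zero factor [t = j-q-1 < i]. *)
Lemma sum_catr_mod3 (F : fieldType) (p i q s J : nat) :
  p \in [pchar F] -> (i < p)%N -> (s < 3)%N -> (p - i = 3 * q + s)%N ->
  (i + 2 < 3 * J.+1 + s)%N -> (J <= i + q)%N ->
  \sum_(0 <= m < p) 'C(m + i, i)%:R * catr F m
    = \sum_(0 <= j < J.+1)
        (-1) ^+ (j + s).+1 * 'C(i + 2, 3 * j + s)%:R
          * (i`!%:R^-1 * \prod_(0 <= t < i) (j%:R - q%:R - 1 - t%:R))
      - (i == 0%N)%:R :> F.
Proof.
move=> charFp lt_ip lt_s3 pi_qs lt_iJ le_Ji.
rewrite (sum_catr_rev charFp lt_ip lt_s3 pi_qs); congr (_ - _).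
set g := fun j : nat => (-1) ^+ (j + s).+1 * 'C(i + 2, 3 * j + s)%:R
          * (i`!%:R^-1 * \prod_(0 <= t < i) (j%:R - q%:R - 1 - t%:R)) : F.
have gJ j : (J < j)%N -> g j = 0.
  by move=> lt_Jj; rewrite /g bin_small ?mulr0 ?mul0r //; lia.
have gq j : (q < j)%N -> g j = 0.
  move=> lt_qj; have [lt_Jj|le_jJ] := ltnP J j; first exact: gJ.
  rewrite /g (bigD1_seq (j - q.+1)%N) ?mem_index_iota ?iota_uniq //=; last by lia.
  have -> : j%:R - q%:R - 1 - (j - q.+1)%:R = 0 :> F.
    by rewrite natrB // -(natr1 q); ring.
  by rewrite mul0r !mulr0.
have gE m n : (forall j, (m < j)%N -> g j = 0) -> (m <= n)%N ->
    \sum_(0 <= j < n.+1) g j = \sum_(0 <= j < m.+1) g j.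
  move=> g0 le_mn; rewrite (big_cat_nat_idem _ (n := m.+1)) //=; last exact: addr0.
  rewrite [X in _ + X]big1_seq ?addr0 // => j /andP[_].
  by rewrite mem_index_iota => /andP[lt_mj _]; exact: g0.
rewrite -(gE J (J + q)%N gJ) ?leq_addr // (gE q (J + q)%N gq) ?leq_addl //.
apply: eq_big_nat => j lt_j; rewrite /g.
have -> : i`!%:R^-1 * \prod_(0 <= t < i) (j%:R - q%:R - 1 - t%:R)
    = (-1) ^+ i * 'C(q - j + i, i)%:R :> F.
  rewrite (sign_bin_add _ charFp) //; congr (_ * _); apply: eq_bigr => t _.
  by rewrite natrB; [ring | lia].
have -> : (-1) ^+ (q - j) = (-1) ^+ (j + s).+1 * (-1) ^+ i :> F.
  (* As [(-1)^(p+1) = 1] in [F], adding [p+1] to the exponent is harmless; with [p = i+3q+s] the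
     parities then agree. *)
  transitivity ((-1) ^+ (p.+1 + (q - j)) : F).
    by rewrite exprD exprS (signr_pchar charFp) mulrNN !mul1r.
  by rewrite -exprD; apply: signr_eq_odd; lia.
by ring.
Qed.

(** * Residues of [p]-integral rationals *)

(* [reduces x a]: the p-integral rational [x] has residue [a] in the field [F] of
   characteristic p *)
Definition reduces (F : fieldType) (x : rat) (a : F) : Prop :=
  exists u v : int, [/\ v%:~R != 0 :> F, x = u%:~R / v%:~R & a = u%:~R / v%:~R].

Lemma intr_rat_neq0 (F : fieldType) (v : int) : v%:~R != 0 :> F -> v%:~R != 0 :> rat.
Proof. by rewrite intr_eq0; apply: contraNneq => ->. Qed.

Lemma reduces_int (F : fieldType) (z : int) : reduces z%:~R (z%:~R : F).
Proof. by exists z, 1; rewrite mulr1z oner_eq0 !divr1. Qed.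

Lemma reduces_nat (F : fieldType) (n : nat) : reduces n%:R (n%:R : F).
Proof. exact: (reduces_int F n). Qed.

Lemma reducesD (F : fieldType) (x y : rat) (a b : F) :
  reduces x a -> reduces y b -> reduces (x + y) (a + b).
Proof.
move=> [u [v [v0 -> ->]]] [u' [v' [v'0 -> ->]]].
exists (u * v' + u' * v), (v * v'); rewrite !intrM !intrD !intrM mulf_neq0 //.
by rewrite !addf_div ?(intr_rat_neq0 v0) ?(intr_rat_neq0 v'0).
Qed.

Lemma reducesM (F : fieldType) (x y : rat) (a b : F) :
  reduces x a -> reduces y b -> reduces (x * y) (a * b).
Proof.
move=> [u [v [v0 -> ->]]] [u' [v' [v'0 -> ->]]].
by exists (u * u'), (v * v'); rewrite !intrM mulf_neq0 // !mulf_div.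
Qed.

Lemma reducesN (F : fieldType) (x : rat) (a : F) : reduces x a -> reduces (- x) (- a).
Proof. by move=> [u [v [v0 -> ->]]]; exists (- u), v; rewrite !mulrNz !mulNr. Qed.

Lemma reducesB (F : fieldType) (x y : rat) (a b : F) :
  reduces x a -> reduces y b -> reduces (x - y) (a - b).
Proof. by move=> xa yb; apply: reducesD => //; exact: reducesN. Qed.

Lemma reducesV_nat (F : fieldType) (n : nat) :
  n%:R != 0 :> F -> reduces n%:R^-1 (n%:R^-1 : F).
Proof. by move=> n0; exists 1, n%:Z; rewrite -!pmulrn !mul1r. Qed.

Lemma reduces_sign (F : fieldType) (n : nat) : reduces ((-1) ^+ n) ((-1) ^+ n : F).
Proof.
by have := reduces_int F ((-1) ^+ n); rewrite !rmorphXn /= !rmorphN1.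
Qed.

Lemma reduces_sum (F : fieldType) (m n : nat) (x : nat -> rat) (a : nat -> F) :
  (forall i, (m <= i < n)%N -> reduces (x i) (a i)) ->
  reduces (\sum_(m <= i < n) x i) (\sum_(m <= i < n) a i).
Proof.
move=> xa; rewrite big_seq [X in reduces _ X]big_seq.
apply: (big_ind2 (@reduces F)); first exact: (reduces_nat F 0).
  by move=> *; exact: reducesD.
by move=> i; rewrite mem_index_iota; exact: xa.
Qed.

Lemma reduces_prod (F : fieldType) (m n : nat) (x : nat -> rat) (a : nat -> F) :
  (forall i, reduces (x i) (a i)) ->
  reduces (\prod_(m <= i < n) x i) (\prod_(m <= i < n) a i).
Proof.
move=> xa; apply: (big_ind2 (@reduces F)); first exact: (reduces_nat F 1).
  by move=> *; exact: reducesM.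
by move=> i _; exact: xa.
Qed.

Lemma reduces_qcong (F : fieldType) (p : nat) (x y : rat) (a : F) :
  p \in [pchar F] -> reduces x a -> reduces y a -> qcong p x y.
Proof.
move=> charFp xa ya; have := reducesB xa ya.
rewrite subrr => -[u [v [v0 xy uv0]]]; exists u, v; rewrite xy.
rewrite !(dvdz_pcharf charFp) v0; split=> //.
by move/eqP: uv0; rewrite eq_sym mulf_eq0 invr_eq0 (negPf v0) orbF.
Qed.

(** * Reduction of rational binomials, Catalan numbers and [f_] *)

Lemma binomq_nat (n k : nat) : binomq n%:R k = 'C(n, k)%:R.
Proof.
have k0 : k`!%:R != 0 :> rat by rewrite pnatr_eq0 -lt0n fact_gt0.
by apply: (mulfI k0); rewrite /= mulVKf // -natr_ffact mulrC -natrM bin_ffact.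
Qed.

(** Multiply by [n+1] and use [(n+1) C(2n,n+1) = n C(2n,n)]. *)
Lemma catalanE (n : nat) : catalan n = catr rat n.
Proof.
rewrite /catalan binomq_nat /catr.
have n0 : n.+1%:R != 0 :> rat by rewrite pnatr_eq0.
apply: (mulfI n0); rewrite mulVKf // mulrBr -!natrM mul_bin_left mul2n -addnn addnK.
by rewrite !natrM -natr1; ring.
Qed.

Lemma reduces_catalan (F : fieldType) (n : nat) : reduces (catalan n) (catr F n).
Proof. by rewrite catalanE; apply: reducesB; exact: reduces_nat. Qed.

Lemma reduces_binomq (F : fieldType) (p i : nat) (x : rat) (a : F) :
  p \in [pchar F] -> (i < p)%N -> reduces x a ->
  reduces (binomq x i) (i`!%:R^-1 * \prod_(0 <= t < i) (a - t%:R)).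
Proof.
move=> charFp lt_ip xa; apply: reducesM.
  by apply: reducesV_nat; exact: pchar_fact_neq0 charFp lt_ip.
by apply: reduces_prod => t; apply: reducesB => //; exact: reduces_nat.
Qed.

Lemma floor_divq3 (n : nat) : Num.floor (n%:R / 3 : rat) = (n %/ 3)%N.
Proof.
apply: floor_def; rewrite -[_ + 1]/(((n %/ 3)%N + 1)%N%:Z) -!pmulrn.
rewrite ler_pdivlMr // ltr_pdivrMr // -!natrM ler_nat ltr_nat.
by rewrite addn1 -ltn_divLR // ltnSn leq_divM.
Qed.

(** Representatives -1, 0, 1 of [p-i-1] correspond to remainders 0, 1, 2 of [p-i]; so [eps + 1] is
    the [s] of [sum_catr_mod3]. *)
Lemma epsE (p i : nat) : (i < p)%N -> eps p i = ((p - i) %% 3)%N%:Z - 1.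
Proof.
move=> lt_ip; apply/esym/eqP; rewrite /eps -leg3P; last first.
  by case: (_ %% 3)%N (ltn_pmod (p - i) (isT : (0 < 3)%N)) => [|[|[|]]].
rewrite eqz_modDr; apply/eqP.
by rewrite subzn ?(ltnW lt_ip) // !modz_nat modn_mod.
Qed.

Lemma exprz_signB1 (n : nat) : (-1) ^ (n%:Z - 1) = (-1) ^+ n.+1 :> rat.
Proof. by rewrite expfzDr // exprS mulrC. Qed.

Lemma binomq0 (x : rat) : binomq x 0 = 1.
Proof. by rewrite /= big_geq // invr1 mul1r. Qed.

(** This and the next two values are all that [p = 3] requires. The upper arguments are integers
    there, or stand over 0. *)
Lemma f0N1 : f_ 0 (-1) = 1.
Proof. by rewrite /f_ (floor_divq3 2) big_nat1 !binomq0. Qed.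

Lemma f11 : f_ 1 1 = 0.
Proof.
rewrite /f_ (floor_divq3 1) big_nat1.
by rewrite [_ + _ / _](_ : _ = 0%:R) // [binomq 0%:R _]binomq_nat mulr0.
Qed.

Lemma f20 : f_ 2 0 = 1.
Proof.
rewrite /f_ (floor_divq3 3) big_nat_recl // big_nat1.
rewrite [0%:R + _ / _](_ : _ = 0%:R) // [1%:R + _ / _](_ : _ = 1%:R) //.
by rewrite ![binomq _%:R 2](@binomq_nat _ 2) !mulr0.
Qed.

(* The division by 3 in [f_] is meaningless modulo 3, so [p = 3] is computed by hand *)
Lemma reduces_f3 (F : fieldType) (p i : nat) :
  p \in [pchar F] -> (i < p)%N -> p = 3%N ->
  reduces (f_ i (eps p i)) (\sum_(0 <= m < p) 'C(m + i, i)%:R * catr F m).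
Proof.
move=> + + p3; rewrite p3 => charF3 lt_i3.
have F3 m n : (3 * m + n)%:R = n%:R :> F.
  by rewrite natrD natrM (pcharf0 charF3) mul0r add0r.
have c0 : catr F 0 = 1%:R by rewrite /catr -natrB.
have c1 : catr F 1 = 1%:R by rewrite /catr -natrB.
have c2 : catr F 2 = 2%:R by rewrite /catr -natrB.
rewrite !big_nat_recr //= big_geq // c0 c1 c2 add0r -!natrM -!natrD.
case: i lt_i3 => [|[|[|//]]] _.
(* The three sums are 4, 9 and 16, that is 1, 0 and 1 modulo 3. *)
- have -> : eps 3 0 = -1 by [].
  rewrite f0N1 (F3 1 1)%N; exact: (reduces_nat F 1).
- have -> : eps 3 1 = 1 by [].
  rewrite f11 (F3 3 0)%N; exact: (reduces_nat F 0).
- have -> : eps 3 2 = 0 by [].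
  rewrite f20 (F3 5 1)%N; exact: (reduces_nat F 1).
Qed.

Lemma reduces_f (F : fieldType) (p i : nat) :
  p \in [pchar F] -> (i < p)%N ->
  reduces (f_ i (eps p i)) (\sum_(0 <= m < p) 'C(m + i, i)%:R * catr F m).
Proof.
move=> charFp lt_ip; have p_pr := pcharf_prime charFp.
have [p3|p_neq3] := eqVneq p 3%N; first exact: reduces_f3.
have p_mod3 : ~~ (3 %| p)%N.
  by rewrite dvdn_prime2 // eq_sym.
have F3 : 3 != 0 :> F.
  by rewrite -(dvdn_pcharf charFp) dvdn_prime2.
rewrite epsE // /f_; set s := ((p - i) %% 3)%N; set q := ((p - i) %/ 3)%N.
have lt_s3 : (s < 3)%N by rewrite ltn_mod.
have pi_qs : (p - i = 3 * q + s)%N by rewrite mulnC -divn_eq.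
have -> : i%:Z + 1 - (s%:Z - 1) = (i + 2 - s)%N by lia.
set J := ((i + 2 - s) %/ 3)%N.
rewrite -pmulrn floor_divq3 -/J.
rewrite (sum_catr_mod3 charFp lt_ip lt_s3 pi_qs (J := J)); [|rewrite /J; lia..].
rewrite -addrA; apply: reducesD.
  apply: reduces_sum => k _.
  have -> : k%:Z + (s%:Z - 1) = (k + s)%N%:Z - 1 by lia.
  have -> : 3 * k%:Z + 1 + (s%:Z - 1) = (3 * k + s)%N by lia.
  rewrite exprz_signB1 binomq_nat.
  apply: reducesM; first by apply: reducesM; [exact: reduces_sign|exact: reduces_nat].
  apply: (reduces_binomq charFp lt_ip).
  (* [i + s = p - 3 q], and [p / 3] vanishes modulo [p] *)
  have -> : k%:R + (i%:Z - 2 + (s%:Z - 1))%:~R / 3 = k%:R - q%:R - 1 + p%:R / 3 :> rat.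
    have -> : i%:Z - 2 + (s%:Z - 1) = p%:Z - 3 * q%:Z - 3 by lia.
    by rewrite !intrD !mulrNz intrM -!pmulrn; field.
  rewrite -[X in reduces _ X]addr0; apply: reducesD.
    apply: reducesB (reduces_nat F 1).
    by apply: reducesB; exact: reduces_nat.
  rewrite -[0](mul0r 3^-1) -(pcharf0 charFp).
  by apply: reducesM; [exact: reduces_nat|exact: reducesV_nat].
(* If [s = 1] and 3 divides [i+1], then 3 divides [p], which is excluded. *)
have -> : (s%:Z - 1 == 0) && (3 %| i.+1)%N = false by lia.
rewrite add0r; case: eqVneq => [i0|_]; last by rewrite mul0r oppr0; exact: (reduces_nat F 0).
(* For [i = 0], [s = 0] would again make 3 divide [p]; the bracket is thus -1, the correction term
   of [sum_catr_mod3]. *)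
have -> : (s%:Z - 1 == -1) = false by lia.
rewrite mul1r mulr0 sub0r; exact: (reduces_int F (-1)).
Qed.

(** * Shifting the index by [d], and Vandermonde *)

(** Put [m = k+d]. The range [m < p] gives the part [d <= m] of the last sum. For [m >= p], [catrDp]
    gives two copies of the sum over [k < d]: one is kept, the other supplies the missing [m < d],
    its upper argument being raised by [p]. *)
Lemma sum_bin_catr_shift (F : fieldType) (p d r : nat) :
  p \in [pchar F] -> (d < p)%N -> (r < p)%N ->
  \sum_(0 <= k < p) 'C(p.-1 - k, r)%:R * catr F (k + d)
    = \sum_(0 <= k < d) 'C(d.-1 - k, r)%:R * catr F k
      + \sum_(0 <= m < p) 'C(d + (p.-1 - m), r)%:R * catr F m.
Proof.
move=> charFp lt_dp lt_rp.
rewrite (big_cat_nat_idem _ (n := (p - d)%N)) //=; [|exact: addr0|lia].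
rewrite [X in _ = _ + X](big_cat_nat_idem _ (n := d)) //=; [|exact: addr0|lia].
have -> : \sum_(0 <= i < p - d) 'C(p.-1 - i, r)%:R * catr F (i + d)
    = \sum_(d <= i < p) 'C(d + (p.-1 - i), r)%:R * catr F i.
  rewrite -[X in \sum_(X <= _ < p) _]add0n big_addn; apply: eq_big_nat => k lt_k.
  by congr ('C(_, _)%:R * _); lia.
have -> : \sum_(p - d <= i < p) 'C(p.-1 - i, r)%:R * catr F (i + d)
    = \sum_(0 <= k < d) 2 * ('C(d.-1 - k, r)%:R * catr F k).
  rewrite -[X in \sum_(X <= _ < p) _]add0n big_addn subKn ?(ltnW lt_dp) //.
  apply: eq_big_nat => k lt_k; rewrite mulrCA -(catrDp charFp); last by lia.
  by congr ('C(_, _)%:R * catr F _); lia.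
have -> : \sum_(0 <= i < d) 'C(d + (p.-1 - i), r)%:R * catr F i
    = \sum_(0 <= k < d) 'C(d.-1 - k, r)%:R * catr F k.
  apply: eq_big_nat => k lt_k; rewrite -[in RHS](bin_addp_pchar _ charFp) //.
  by congr ('C(_, _)%:R * _); lia.
by rewrite -mulr_sumr; ring.
Qed.

(** Split the upper argument as [(p-1-m) + d]; each [C(p-1-m,i)] is [(-1)^i C(m+i,i)] in [F]. *)
Lemma sum_bin_catr_Vandermonde (F : fieldType) (p d r : nat) :
  p \in [pchar F] -> (r < p)%N ->
  \sum_(0 <= m < p) 'C(d + (p.-1 - m), r)%:R * catr F m
    = \sum_(0 <= i < r.+1) (-1) ^+ i * 'C(d, r - i)%:R
        * \sum_(0 <= m < p) 'C(m + i, i)%:R * catr F m.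
Proof.
move=> charFp lt_rp.
under [RHS]eq_bigr do rewrite mulr_sumr.
rewrite exchange_big /=; apply: eq_big_nat => m lt_mp.
rewrite addnC -binomial.Vandermonde natr_sum mulr_suml big_mkord.
apply: eq_bigr => -[i /= lt_ir] _.
rewrite natrM -(bin_neg_pchar charFp); [by ring|lia..].
Qed.

Theorem theorem1p3 (p d r : nat) (p_prime : prime p)
    (d_lt_p : (d < p)%N) (r_lt_p : (r < p)%N) :
  qcong p
    ((-1) ^+ r * \sum_(0 <= k < p) binomq (k + r)%:R r * catalan (k + d))
    (\sum_(0 <= k < d) binomq (d%:Z - 1 - k%:Z)%:Q r * catalan k
     + \sum_(0 <= i < r.+1)
         (-1) ^+ i * binomq d%:R (r%:Z - i%:Z) * f_ i (eps p i)).
Proof.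
have [F charFp] : exists F : fieldType, p \in [pchar F].
  by exists 'F_p; exact: pchar_Fp.
(* The common residue is the left side read in [F]; the rest shows that the right side reduces to it
   as well. *)
apply: (reduces_qcong (a :=
  (-1) ^+ r * \sum_(0 <= k < p) 'C(k + r, r)%:R * catr F (k + d)) charFp).
  apply: reducesM; first exact: reduces_sign.
  apply: reduces_sum => k _; rewrite binomq_nat.
  by apply: reducesM; [exact: reduces_nat|exact: reduces_catalan].
have -> : (-1) ^+ r * \sum_(0 <= k < p) 'C(k + r, r)%:R * catr F (k + d)
    = \sum_(0 <= k < p) 'C(p.-1 - k, r)%:R * catr F (k + d).
  rewrite mulr_sumr; apply: eq_big_nat => k lt_kp.
  by rewrite mulrA (bin_neg_pchar charFp).
rewrite sum_bin_catr_shift // sum_bin_catr_Vandermonde //.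
apply: reducesD; apply: reduces_sum => i lt_i.
  have -> : d%:Z - 1 - i%:Z = (d.-1 - i)%N by lia.
  rewrite [binomq _ _]binomq_nat.
  by apply: reducesM; [exact: reduces_nat|exact: reduces_catalan].
rewrite subzn ?binomq_nat; last by lia.
apply: reducesM; last by apply: reduces_f => //; lia.
by apply: reducesM; [exact: reduces_sign|exact: reduces_nat].
Qed.
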